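(* Let $\sigma\ge0$, let $F:[0,1]^n\to\mathbb{R}_{\ge0}$ be a monotone one-sided $\sigma$-smooth function all of whose third-order partial derivatives are non-positive, let $\alpha\in[0,1)$, and let $P\subseteq[0,1]^n$ be a polytime separable, downward-closed polytope. Let $x(t)$ be the trajectory of the jump-start continuous greedy process with parameter $\alpha$. Then $x(1)\in P$ and \[ F(x(1))\ge\Big[1-\exp\Big(-\frac{\alpha(1-\alpha)}{\alpha+\sigma}\Big)\Big]\cdot OPT, \] where $OPT=\max\{F(x):x\in P\}$. In particular, for $\alpha=1/2$, $F(x(1))\ge[1-\exp(-\frac{1}{4\sigma+2})]\cdot OPT\ge\frac{1}{4\sigma+3}\cdot OPT$.
   Context: $F$ is of class $C^3$ and monotone means nondecreasing in each coordinate. $F$ is one-sided $\sigma$-smooth if for all $u,x\ge0$ with $x\ne0$: $\frac12u^T\nabla^2F(x)u\le\sigma\frac{\|u\|_1}{\|x\|_1}u^T\nabla F(x)$. $P$ is downward-closed if $y\in P$, $0\le x\le y$ imply $x\in P$. Jump-start continuous greedy with parameter $\alpha$: let $v^*\in\arg\max_{x\in P}\|x\|_1$, $v_{max}(x)\in\arg\max_{v\in P}v^T\nabla F(x)$, and $x(t)$ solves $x'(t)=(1-\alpha)v_{max}(x(t))$, $t\in[0,1]$, $x(0)=\alpha v^*$. *)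

(* Defs.v *)
From HB Require Import structures.
From mathcomp Require Import all_boot all_order all_algebra.
From mathcomp Require Import all_classical all_reals all_analysis.

Set Implicit Arguments.
Unset Strict Implicit.
Unset Printing Implicit Defensive.

Import Order.TTheory GRing.Theory Num.Theory.
Import numFieldNormedType.Exports.

Local Open Scope classical_set_scope.
Local Open Scope ring_scope.

Section Vectors.
Context {R : realType} {n : nat}.
Implicit Types (x y u v : 'rV[R]_n) (P : set 'rV[R]_n).

Definition lev x y : Prop := forall i, x ord0 i <= y ord0 i.

Definition unit_cube : set 'rV[R]_n := [set x | lev 0 x /\ lev x (const_mx 1)].

(* The library norm on 'rV[R]_n is the sup norm, hence this definition. *)
Definition norm1 x : R := \sum_i `|x ord0 i|.

Definition dotv u v : R := \sum_i u ord0 i * v ord0 i.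

Definition downward_closed P : Prop :=
  forall x y, P y -> lev 0 x -> lev x y -> P x.

(* A polytope is a bounded intersection of finitely many half-spaces. *)
Definition polytope P : Prop :=
  (exists m (A : 'M[R]_(m, n)) (b : 'cV[R]_m),
     P = [set x | forall k, (A *m x^T) k ord0 <= b k ord0])
  /\ bounded_set P.

End Vectors.

Section Maxima.
Context {R : realType} {T : Type}.

Definition argmax (P : set T) (f : T -> R) : set T :=
  [set v | P v /\ forall w, P w -> f w <= f v].

Definition is_max (P : set T) (f : T -> R) (m : R) : Prop :=
  (exists2 v, P v & f v = m) /\ (forall w, P w -> f w <= m).

End Maxima.

Section Smoothness.
Context {R : realType} {n : nat}.
Implicit Types (F : 'rV[R]_n -> R) (U : set 'rV[R]_n) (x u : 'rV[R]_n).

Definition partial (i : 'I_n) F : 'rV[R]_n -> R :=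
  fun x => 'D_(delta_mx ord0 i) F x.

Definition grad F x : 'rV[R]_n := \row_i partial i F x.

Definition hess F x : 'M[R]_n := \matrix_(i, j) partial i (partial j F) x.

(* Meant for U open: all iterated partial derivatives of F of order at most k
   exist and are continuous on U. *)
Fixpoint Ck (k : nat) U F : Prop :=
  (forall x, U x -> {for x, continuous F}) /\
  (if k is k'.+1 then
     forall i, (forall x, U x -> derivable F x (delta_mx ord0 i))
               /\ Ck k' U (partial i F)
   else True).

(* A function on the (closed) cube is C^3 when it has a C^3 extension to an
   open neighbourhood of the cube.  As F is a total function, it is taken to be
   such an extension; the derivatives of F at points of the cube depend only on
   the restriction of F to the cube. *)
Definition C3_on_cube F : Prop :=
  exists U : set 'rV[R]_n, [/\ open U, unit_cube `<=` U & Ck 3 U F].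

Definition monotone_on_cube F : Prop :=
  forall x y, unit_cube x -> unit_cube y -> lev x y -> F x <= F y.

Definition one_sided_smooth (sigma : R) F : Prop :=
  forall u x, lev 0 u -> unit_cube x -> x != 0 ->
    2^-1 * (u *m hess F x *m u^T) ord0 ord0
    <= sigma * (norm1 u / norm1 x) * dotv u (grad F x).

Definition third_partials_nonpos F : Prop :=
  forall (i j k : 'I_n) x, unit_cube x ->
    partial i (partial j (partial k F)) x <= 0.

End Smoothness.

Section Trajectories.
Context {R : realType}.

Definition abs_continuous {V : normedModType R} (a b : R) (x : R -> V) : Prop :=
  forall e : R, 0 < e -> exists2 d : R, 0 < d &
    forall (m : nat) (l r : 'I_m -> R),
      (forall k, [/\ a <= l k, l k <= r k & r k <= b]) ->
      trivIset setT (fun k => `]l k, r k[%classic) ->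
      \sum_k (r k - l k) < d ->
      \sum_k `|x (r k) - x (l k)| < e.

(* Solution on [a, b] of x' = f(x), x(a) = x0, in the sense of Caratheodory:
   x is absolutely continuous and the equation holds almost everywhere.  The
   right-hand side may be discontinuous, and every differentiable solution with
   bounded derivative is a solution in this sense. *)
Definition ode_solution {V : normedModType R} (f : V -> V) (x0 : V) (a b : R)
    (x : R -> V) : Prop :=
  [/\ abs_continuous a b x, x a = x0 &
      {ae (@lebesgue_measure R), forall t : R,
        a < t < b -> is_derive t 1 x (f (x t))}].

(* As F lives on the cube, v_max is only specified there and the trajectory is
   required to stay there. *)
Definition jump_start_trajectory {n : nat} (F : 'rV[R]_n -> R)
    (P : set 'rV[R]_n) (alpha : R) (x : R -> 'rV[R]_n) : Prop :=
  exists (vstar : 'rV[R]_n) (vmax : 'rV[R]_n -> 'rV[R]_n),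
    [/\ argmax P norm1 vstar,
        forall y, unit_cube y -> argmax P (fun v => dotv v (grad F y)) (vmax y),
        forall t, 0 <= t <= 1 -> unit_cube (x t) &
        ode_solution (fun y => (1 - alpha) *: vmax y) (alpha *: vstar) 0 1 x].

End Trajectories.

(* Main.v *)
Require Import Defs.
From HB Require Import structures.
From mathcomp Require Import all_boot all_order all_algebra.
From mathcomp Require Import all_classical all_reals all_analysis.
From mathcomp Require Import measurable_realfun ring lra.
Set Implicit Arguments.
Unset Strict Implicit.
Unset Printing Implicit Defensive.
Import Order.TTheory GRing.Theory Num.Theory.
Import numFieldNormedType.Exports.
Local Open Scope classical_set_scope.
Local Open Scope ring_scope.

(** Write u = (x* - x(t))^+ for an optimum x*. Along the segment from x(t) to
    x(t) + u = x(t) \/ x* the third derivative of F is non-positive, so F is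
    bounded by its second-order Taylor polynomial, and one-sided smoothness
    together with ||u||_1 <= ||v*||_1 <= ||x(t)||_1 / alpha gives
    OPT - F(x(t)) <= (1 + sigma / alpha) u . grad F(x(t)).
    The greedy direction does at least as well as u, hence
    (F o x)' >= c (OPT - F o x) almost everywhere, with
    c = alpha (1 - alpha) / (alpha + sigma), and
    t |-> exp(c t) (F(x(t)) - OPT), being absolutely continuous, is
    nondecreasing.  The same monotonicity principle applied to each
    half-space of P shows that x(1) is in P. *)

(** * Monotonicity of absolutely continuous functions *)

Lemma is_derive_approx (R : realType) (f : R -> R) (t d e : R) :
  is_derive t 1 f d -> 0 < e ->
  exists2 eta : R, 0 < eta &
    forall s, `|s - t| < eta -> `|f s - f t - d * (s - t)| <= e * `|s - t|.
Proof.
move=> [df fd] e0.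
have : (fun h => h^-1 *: ((f \o shift t) (h *: 1) - f t)) @ 0^' --> d.
  by rewrite -fd; exact: df.
move/cvgrPdist_le => /(_ _ e0).
rewrite near_withinE => /nbhs_ballP[eta /= eta0 H].
exists eta => // s st.
have [->|snt] := eqVneq s t; first by rewrite !subrr mulr0 subr0 !normr0 mulr0.
have st0 : s - t != 0 by rewrite subr_eq0.
have := H (s - t).
rewrite /ball /= sub0r normrN st0 => /(_ st isT).
rewrite /shift /= /GRing.scale/= mulr1 subrK => K.
have -> : f s - f t - d * (s - t) = - (d - (s - t)^-1 * (f s - f t)) * (s - t).
  by field.
by rewrite normrM normrN ler_wpM2r.
Qed.

Lemma abs_continuousW (R : realType) (V : normedModType R) (a b c : R)
    (f : R -> V) :
  c <= b -> abs_continuous a b f -> abs_continuous a c f.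
Proof.
move=> cb fAC e e0; have [d d0 H] := fAC e e0; exists d => // m l r lr.
apply: H => k; have [al lrk rc] := lr k; split => //.
exact: le_trans cb.
Qed.

(** Outer regularity is applied to a measurable null set [A] containing [N]. It bounds only the part
    of [O] outside [A], and adding back [A] does not change the measure. *)
Lemma negligible_open_cover (R : realType) (N : set R) (d : R) :
  0 < d -> (@lebesgue_measure R).-negligible N ->
  exists O : set R, [/\ open O, N `<=` O & (lebesgue_measure O < d%:E)%E].
Proof.
move=> d0 [A [mA A0 NA]].
have [|O [oO AO Od]] := lebesgue_regularity_outer mA _ d0.
  by rewrite /= A0 ltry.
exists O; split => //; first exact: subset_trans AO.
rewrite (_ : O = O `\` A `|` A); last by rewrite setDE setUIl setUCl setIT setUidl.
rewrite measureU0//; apply: measurableD => //; exact: open_measurable.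
Qed.

Lemma sum_itv_le_measure (R : realType) (m : nat) (l r : 'I_m -> R)
    (O : set R) :
  (forall k, l k <= r k) -> trivIset setT (fun k => `]l k, r k[%classic) ->
  measurable O -> (forall k, `]l k, r k[%classic `<=` O) ->
  ((\sum_k (r k - l k))%:E <= lebesgue_measure O)%E.
Proof.
move=> lr triv mO lrO.
have -> : (\sum_k (r k - l k))%:E =
    lebesgue_measure (\big[setU/set0]_(k < m) `]l k, r k[%classic).
  rewrite measure_bigsetU_ord//=.
  rewrite -sumEFin; apply: eq_bigr => k _.
  rewrite lebesgue_measure_itv/= lte_fin.
  have [//|] := ltP (l k) (r k).
  move=> rl; have -> : l k = r k by apply/eqP; rewrite eq_le lr rl.
  by rewrite subrr.
apply: le_measure; rewrite ?inE//.
  by apply: bigsetU_measurable => k _; exact: measurable_itv.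
elim/big_ind : _ => [t []|X Y XO YO t [/XO|/YO]|k _]//; exact: lrO.
Qed.

Section AbsContinuousMonotone.
Variables (R : realType) (a e : R) (f : R -> R) (O : set R).

(* Up to a defect of slope [e], [f] decreases from [a] to [c] at most by its
   variation on finitely many ordered intervals contained in [O]. *)
Definition controlled_decrease (c : R) : Prop :=
  exists m (l r : nat -> R),
    [/\ forall k, (k < m)%N ->
          [/\ a <= l k, l k <= r k, r k <= c & `]l k, r k[%classic `<=` O],
        forall j k, (j < k < m)%N -> r j <= l k &
        f a - f c <= e * (c - a) + \sum_(k < m) `|f (r k) - f (l k)|].

Lemma controlled_decrease_start : controlled_decrease a.
Proof.
exists 0%N, (fun=> 0), (fun=> 0); split => //.
by rewrite big_ord0 !subrr mulr0 addr0.
Qed.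

Lemma controlled_decrease_slope (c c' : R) :
  c <= c' -> f c - f c' <= e * (c' - c) ->
  controlled_decrease c -> controlled_decrease c'.
Proof.
move=> cc' fcc' [m [l [r [lr ord H]]]]; exists m, l, r; split => //.
  move=> k /lr [al lrk rc sO]; split => //; exact: le_trans cc'.
lra.
Qed.

(** The decrease from [c] to [c'] is charged to the variation of [f] on one new interval. It can be
    appended last, since all earlier intervals end by [c]. *)
Lemma controlled_decrease_jump (c c' : R) :
  a <= c -> c <= c' -> 0 <= e -> `]c, c'[%classic `<=` O ->
  controlled_decrease c -> controlled_decrease c'.
Proof.
move=> ac cc' e0 cO [m [l [r [lr ord H]]]].
exists m.+1, (fun k => if (k < m)%N then l k else c),
  (fun k => if (k < m)%N then r k else c'); split.
- move=> k km; case: ifPn => [/lr [al lrk rc sO]|_]; last by [].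
  by split => //; exact: le_trans cc'.
- move=> j k /andP[jk km].
  have jm : (j < m)%N by rewrite (leq_trans jk).
  rewrite jm; case: ifPn => [km'|_]; first by rewrite ord// jk.
  by have [] := lr j jm.
- rewrite big_ord_recr/= ltnn.
  under eq_bigr do rewrite ltn_ord.
  have := ler_norm (f c - f c'); rewrite distrC.
  have : 0 <= e * (c' - c) by rewrite mulr_ge0// subr_ge0.
  lra.
Qed.

End AbsContinuousMonotone.

(** The exceptional points are covered by an open [O] so small that absolute continuity makes the
    variation on intervals inside [O] less than [e]. A supremum argument carries the controlled
    decrease from [a] to [b]: points of [O] are passed by a jump, the others by their derivative. *)
Lemma abs_continuous_ae_deriv_ge0_le (R : realType) (a b : R) (f : R -> R) :
  a <= b -> abs_continuous a b f ->
  {ae (@lebesgue_measure R), forall t : R, a < t < b ->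
     exists2 d : R, 0 <= d & is_derive t 1 f d} ->
  f a <= f b.
Proof.
move=> ab fAC dfae.
suff H (e : R) : 0 < e -> f a - f b <= e * (b - a) + e.
  rewrite -subr_le0; apply/ler_addgt0Pr => e e0; rewrite add0r.
  have ba1 : 0 < b - a + 1 by rewrite ltr_wpDl// subr_ge0.
  have := H (e / (b - a + 1)) (divr_gt0 e0 ba1).
  rewrite -[X in _ <= _ + X]mulr1 -mulrDr divfK//; exact: lt0r_neq0.
move=> e0; have [d d0 Hd] := fAC e e0.
pose diff_ge0 (t : R) := exists2 d : R, 0 <= d & is_derive t 1 f d.
(* The endpoints are covered too, so that a supremum outside [O] is interior and has a
   derivative. *)
have : exists O : set R, [/\ open O,
    (~` [set t | a < t < b -> diff_ge0 t] `|` ([set a] `|` [set b])) `<=` O &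
    (lebesgue_measure O < d%:E)%E].
  apply: negligible_open_cover => //.
  apply: negligibleU => //; apply: negligibleU.
    by apply/negligibleP => //; exact: lebesgue_measure_set1.
  by apply/negligibleP => //; exact: lebesgue_measure_set1.
move=> -[] O [oO NO Od].
pose S := [set c | a <= c <= b /\ controlled_decrease a e f O c].
have Sa : S a by split; [rewrite lexx|exact: controlled_decrease_start].
have ubS : ubound S b by move=> c [/andP[]].
have supS : has_sup S by split; [exists a|exists b].
have asup : a <= sup S by exact: sup_upper_bound.
have sb : sup S <= b by apply: ge_sup => //; exists a.
have [eta eta0 step] : exists2 eta, 0 < eta & forall c c', S c ->
    sup S - eta < c -> c <= sup S -> sup S <= c' -> c' < sup S + eta ->
    c' <= b -> S c'.
  have [Os|nOs] := pselect (O (sup S)).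
    have /nbhs_ballP[eta /= eta0 etaO] : nbhs (sup S) O by exact: open_nbhs_nbhs.
    exists eta => // c c' [/andP[ac cb] Sc] c1 c2 c3 c4 c5; split.
      by rewrite c5 andbT (le_trans asup).
    apply: (controlled_decrease_jump ac _ (ltW e0) _ Sc).
      exact: le_trans c3.
    move=> t /=; rewrite in_itv/= => /andP[ct tc']; apply: etaO.
    rewrite /ball/= ltr_norml; lra.
  have sne u : O u -> sup S != u by move=> Ou; apply: contra_notN nOs => /eqP->.
  have asb : a < sup S < b.
    rewrite !lt_neqAle asup sb sne ?andbT 1?eq_sym ?sne//.
      by apply: NO; right; left.
    by apply: NO; right; right.
  have [dd dd0 fd] : diff_ge0 (sup S).
    by apply: contrapT => nd; apply/nOs/NO; left => /(_ asb).
  have [eta eta0 Heta] := is_derive_approx fd e0.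
  exists eta => // c c' [/andP[ac cb] Sc] c1 c2 c3 c4 c5; split.
    by rewrite c5 andbT (le_trans asup).
  apply: (controlled_decrease_slope _ _ Sc); first exact: le_trans c3.
  have cN : `|c - sup S| = sup S - c by rewrite ler0_norm ?subr_le0// opprB.
  have c'N : `|c' - sup S| = c' - sup S by rewrite ger0_norm ?subr_ge0.
  have := Heta c; rewrite cN ler_norml => K1.
  have /andP[_ {}K1] := K1 ltac:(lra).
  have := Heta c'; rewrite c'N ler_norml => K2.
  have /andP[{}K2 _] := K2 ltac:(lra).
  (* Since [c <= sup S <= c'], the two first-order errors at [sup S] add up to exactly
     [e * (c' - c)], and the linear part has the right sign. *)
  have : 0 <= dd * (c' - c) by rewrite mulr_ge0// subr_ge0 (le_trans c2).
  nra.
have [_ [m [l [r [lr ord Hb]]]]] : S b.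
  have [c Sc sc] := sup_adherent eta0 supS.
  have cs : c <= sup S by exact: sup_upper_bound.
  (* This point lies in [S], hence does not exceed [sup S]; the minimum is therefore [b]. *)
  pose c' := Num.min b (sup S + eta / 2).
  have Sc' : S c'.
    apply: (step _ _ Sc) => //; rewrite /c' ?ge_min ?lexx// ?le_min ?sb/=.
      by rewrite lerDl divr_ge0// ltW.
    by rewrite gt_min; apply/orP; right; rewrite ltrD2l ltr_pdivrMr// ltr_pMr// ltr1n.
  have : c' <= sup S by exact: sup_upper_bound.
  rewrite /c' ge_min => /orP[bs|]; last by lra.
  by move: Sc'; rewrite /c' min_l// (le_trans bs)// lerDl divr_ge0// ltW.
have triv : trivIset setT (fun k : 'I_m => `]l k, r k[%classic).
  have disj (i j : 'I_m) (t : R) :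
      (i < j)%N -> l i < t < r i -> l j < t < r j -> False.
    move=> ij /andP[_ tr] /andP[lt _].
    have := ord i j; rewrite ij ltn_ord => /(_ isT); lra.
  move=> i j _ _ [t [/= ti tj]]; rewrite !in_itv/= in ti tj.
  have [ij|ij|/val_inj//] := ltngtP (i : nat) (j : nat).
    by case: (disj _ _ _ ij ti tj).
  by case: (disj _ _ _ ij tj ti).
have lr' (k : 'I_m) : [/\ a <= l k, l k <= r k & r k <= b].
  by have [] := lr k (ltn_ord k).
apply: (le_trans Hb); rewrite lerD2l ltW//.
apply: (Hd m (fun k => l k) (fun k => r k)) => //.
rewrite -lte_fin; apply: le_lt_trans Od.
apply: sum_itv_le_measure => //.
- by move=> k; have [] := lr' k.
- exact: open_measurable.
- by move=> k; have [] := lr k (ltn_ord k).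
Qed.

(** * Differentiability from continuous partial derivatives *)

Lemma is_derive_line (R : realType) (V W : normedModType R) (f : V -> W)
    (x v : V) (s : R) (d : W) :
  is_derive (x + s *: v) v f d -> is_derive s 1 (fun s : R => f (x + s *: v)) d.
Proof.
have E : (fun h : R => h^-1 *: (((fun s : R => f (x + s *: v)) \o shift s) (h *: 1) -
      f (x + s *: v))) =
    (fun h => h^-1 *: ((f \o shift (x + s *: v)) (h *: v) - f (x + s *: v))).
  apply/funext => h /=; congr (_ *: (f _ - _)).
  by rewrite (mulr1 h : h *: 1 = h) scalerDl addrCA.
by case=> df fd; split; rewrite ?/derivable ?/derive E.
Qed.

(** The endpoints are unordered because one of them will be a coordinate of arbitrary sign. *)
Lemma MVT_between (R : realType) (f df : R -> R) (a b : R) :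
  (forall s, Num.min a b <= s <= Num.max a b -> is_derive s 1 f (df s)) ->
  exists2 c, Num.min a b <= c <= Num.max a b & f b - f a = df c * (b - a).
Proof.
wlog ab : a b / a <= b => [hwlog H|].
  have [ab|ba] := orP (le_total a b); first exact: hwlog.
  have [|c cab E] := hwlog b a ba; first by rewrite minC maxC.
  exists c; first by rewrite minC maxC.
  by rewrite -opprB E -mulrN opprB.
rewrite min_l// max_r// => H.
have [||c] := @MVT_segment R f df a b ab.
- by move=> s; rewrite in_itv/= => /andP[/ltW ? /ltW ?]; apply/H/andP.
- apply: derivable_within_continuous => s; rewrite in_itv/= => sab; by have [] := H s sab.
- by rewrite in_itv/= => cab E; exists c.
Qed.

Section Dot.
Context {R : realType} {n : nat}.
Implicit Types u v g : 'rV[R]_n.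

Lemma coord_le_norm u i : `|u ord0 i| <= `|u|.
Proof.
rewrite [leRHS]/Num.norm/= mx_normrE.
by apply/bigmax_geP; right; exists (ord0, i).
Qed.

(** With the gradient as first argument, [dotr g] is the linear functional that serves as a
    differential. *)
Definition dotr g u : R := dotv u g.

Lemma dotr_is_linear g : linear (dotr g).
Proof.
move=> k u v; rewrite /dotr /dotv scaler_sumr -big_split; apply: eq_bigr => i _.
by rewrite !mxE mulrDl -mulrA.
Qed.

HB.instance Definition _ g := GRing.isLinear.Build R 'rV[R]_n R *%R (dotr g)
  (dotr_is_linear g).

Lemma dotr_continuous g : continuous (dotr g).
Proof.
apply: (@continuous_big _ _ _ _ _ _ _ _
  (fun i (u : 'rV[R]_n) => u ord0 i * g ord0 i)).
  exact: add_continuous.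
move=> i _ u; have := @coord_continuous R 1 n ord0 i u.
by move=> /cvgMr_tmp; exact.
Qed.

Lemma dotv_norm_le u v (M : R) :
  (forall i, `|v ord0 i| <= M) -> `|dotv u v| <= n%:R * M * `|u|.
Proof.
move=> vM; apply: (le_trans (ler_norm_sum _ _ _)).
rewrite -mulrA mulr_natl -[X in _ *+ X]card_ord -sumr_const; apply: ler_sum => i _.
by rewrite normrM mulrC ler_pM ?coord_le_norm.
Qed.

End Dot.

Section ContinuousPartials.
Context {R : realType} {n : nat}.
Implicit Types (F : 'rV[R]_n -> R) (U : set 'rV[R]_n) (x h : 'rV[R]_n).

(** These are the vertices of a path from [0] to [h] that changes one coordinate at a time. *)
Definition row_prefix h (k : nat) : 'rV[R]_n :=
  \row_i (if (i < k)%N then h ord0 i else 0).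

Lemma norm_row_prefix_le h (k : 'I_n) (s : R) :
  `|row_prefix h k + s *: delta_mx ord0 k| <= Num.max `|h| `|s|.
Proof.
rewrite [leLHS]/Num.norm/= mx_normrE; apply/bigmax_leP; split=> [|[i j] _/=].
  by rewrite le_max normr_ge0.
rewrite !ord1 !mxE eqxx/= le_max; have [->|jk] := eqVneq j k.
  by rewrite ltnn mulr1 add0r lexx orbT.
rewrite mulr0 addr0; case: ifP => _; rewrite ?coord_le_norm//.
by rewrite normr0 normr_ge0.
Qed.

Lemma norm_between0 (a s : R) :
  Num.min 0 a <= s <= Num.max 0 a -> `|s| <= `|a|.
Proof.
have [a0|/ltW a0] := leP 0 a.
  by move=> /andP[s0 sa]; rewrite !ger0_norm.
by move=> /andP[sa s0]; rewrite !ler0_norm// lerN2.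
Qed.

(** The increment of [F] telescopes along the coordinate path. On each edge the mean value theorem
    gives a partial derivative at a point near [x], which continuity compares with the one at
    [x]. *)
Lemma partials_approx U F x (e : R) :
  open U -> Ck 1 U F -> U x -> 0 < e ->
  \forall h \near nbhs (0 : 'rV[R]_n), `|F (x + h) - F x - dotv h (grad F x)| <= e * `|h|.
Proof.
move=> oU [_ CF] Ux e0.
(* Each of the [n] edges contributes an error of at most [e' * |h|]; dividing by [n.+1] keeps [e']
   positive also for [n = 0]. *)
pose e' := e / n.+1%:R; have e'0 : 0 < e' by rewrite divr_gt0.
have nU : nbhs x U by exact: open_nbhs_nbhs.
have nF : \forall y \near x, forall i, `|partial i F y - partial i F x| <= e'.
  apply: (filter_forall (nbhs_filter x)) => i.
  have [_ [/(_ x Ux) cF _]] := CF i.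
  have /cvgrPdist_le/(_ _ e'0) := cF.
  by apply: filterS => y; rewrite distrC.
have : nbhs x (U `&` [set y | forall i, `|partial i F y - partial i F x| <= e']).
  exact: filterI.
move=> /nbhs_ballP[r /= r0 Hr].
apply/nbhs_ballP; exists r => //= h; rewrite -ball_normE/= sub0r normrN => hr.
have telesc : F (x + h) - F x =
    \sum_(k < n) (F (x + row_prefix h k.+1) - F (x + row_prefix h k)).
  rewrite -(big_mkord xpredT
    (fun k => F (x + row_prefix h k.+1) - F (x + row_prefix h k))).
  rewrite telescope_sumr//; congr (F (x + _) - F _).
    by apply/rowP => i; rewrite mxE ltn_ord.
  by rewrite -[LHS]addr0; congr (_ + _); apply/rowP => i; rewrite !mxE.
rewrite telesc /dotv -sumrB; apply: (le_trans (ler_norm_sum _ _ _)).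
have -> : e * `|h| = e' * `|h| *+ n.+1 by rewrite -mulr_natr mulrAC divfK.
apply: (@le_trans _ _ (e' * `|h| *+ n)); last first.
  by rewrite mulrSr lerDl mulr_ge0// ltW.
rewrite -[X in _ *+ X]card_ord -sumr_const; apply: ler_sum => k _.
have dline (s : R) : Num.min 0 (h ord0 k) <= s <= Num.max 0 (h ord0 k) ->
    U (x + row_prefix h k + s *: delta_mx ord0 k) /\
    `|partial k F (x + row_prefix h k + s *: delta_mx ord0 k) -
      partial k F x| <= e'.
  move=> /norm_between0 sh.
  have [|Uy /(_ k)//] := Hr (x + row_prefix h k + s *: delta_mx ord0 k).
  rewrite -ball_normE/= -addrA opprD addNKr normrN.
  apply: le_lt_trans hr; apply: (le_trans (norm_row_prefix_le _ _ _)).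
  by rewrite ge_max lexx (le_trans sh)// coord_le_norm.
have [s sb|c cb] := @MVT_between R
  (fun s => F (x + row_prefix h k + s *: delta_mx ord0 k))
  (fun s => partial k F (x + row_prefix h k + s *: delta_mx ord0 k))
  0 (h ord0 k).
  have [Uy _] := dline s sb.
  apply: is_derive_line; apply: derivableP.
  by have [/(_ _ Uy)] := CF k.
rewrite scale0r addr0 subr0.
have -> : x + row_prefix h k + h ord0 k *: delta_mx ord0 k = x + row_prefix h k.+1.
  rewrite -addrA; congr (_ + _); apply/rowP => i; rewrite !mxE eqxx/= ltnS [in RHS]leq_eqVlt.
  have [->|ik] := eqVneq i k; first by rewrite ltnn eqxx mulr1 add0r.
  by rewrite (_ : (i == k :> nat) = false) ?mulr0 ?addr0//; exact/negbTE.
move=> ->; rewrite mxE mulrC -mulrBr normrM mulrC ler_pM ?coord_le_norm//.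
by have [] := dline c cb.
Qed.

Lemma Ck1_is_diff U F x :
  open U -> Ck 1 U F -> U x -> is_diff x F (dotr (grad F x)).
Proof.
move=> oU CF Ux.
have dF : F \o shift x = cst (F x) + dotr (grad F x) +o_ (0 : 'rV[R]_n) id.
  apply/eqaddoP => e e0.
  apply: filterS (partials_approx oU CF Ux e0) => h.
  by rewrite /= !fctE /= opprD addrA [h + x]addrC.
have E := diff_unique (@dotr_continuous _ _ _) dF.
split => //; apply/diff_locallyP; rewrite E; split => //.
exact: dotr_continuous.
Qed.

Lemma Ck1_is_derive U F x v :
  open U -> Ck 1 U F -> U x -> is_derive x v F (dotv v (grad F x)).
Proof.
move=> oU CF Ux; have [dF E] := Ck1_is_diff oU CF Ux.
by split; [exact: diff_derivable|rewrite deriveE// E].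
Qed.

Lemma Ck1_is_derive_comp U F (x : R -> 'rV[R]_n) (t : R) (x' : 'rV[R]_n) :
  open U -> Ck 1 U F -> U (x t) -> is_derive t 1 x x' ->
  is_derive t 1 (F \o x) (dotv x' (grad F (x t))).
Proof.
move=> oU CF Ux [dx xE]; have [dF E] := Ck1_is_diff oU CF Ux.
have dx' : differentiable x t by exact/derivable1_diffP.
have dFx : differentiable (F \o x) t by exact: differentiable_comp.
split; first exact: diff_derivable.
by rewrite deriveE// diff_comp//= E -xE deriveE.
Qed.

End ContinuousPartials.

(** * Smooth functions on the cube *)

Lemma is_derive_lincomb (R : realType) (n : nat) (c d : 'I_n -> R)
    (g : 'I_n -> R -> R) (s : R) :
  (forall j, is_derive s 1 (g j) (d j)) ->
  is_derive s 1 (fun s => \sum_j c j * g j s) (\sum_j c j * d j).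
Proof.
move=> dg.
have -> : (fun s => \sum_j c j * g j s) = \sum_(j < n) (c j \*: g j).
  by apply/funext => t; rewrite fct_sumE.
by apply: is_derive_sum => j; exact: is_deriveZ.
Qed.

Lemma derive_le0_le (R : realType) (f df : R -> R) (a b : R) :
  a <= b -> (forall s, a <= s <= b -> is_derive s 1 f (df s)) ->
  (forall s, a <= s <= b -> df s <= 0) -> f b <= f a.
Proof.
move=> ab fd df0; have mm : Num.min a b = a /\ Num.max a b = b.
  by rewrite min_l// max_r.
have [|c] := @MVT_between R f df a b; rewrite mm.1 mm.2//.
by move=> /df0 dfc E; rewrite -subr_le0 E mulr_le0_ge0// subr_ge0.
Qed.

(** The sign of [g3] makes [g2] nonincreasing, so [g1] stays below its tangent at [0], so [g] minus
    its quadratic Taylor polynomial is nonincreasing. *)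
Lemma taylor2_le (R : realType) (g g1 g2 g3 : R -> R) :
  (forall s : R, 0 <= s <= 1 -> is_derive s 1 g (g1 s)) ->
  (forall s : R, 0 <= s <= 1 -> is_derive s 1 g1 (g2 s)) ->
  (forall s : R, 0 <= s <= 1 -> is_derive s 1 g2 (g3 s)) ->
  (forall s : R, 0 <= s <= 1 -> g3 s <= 0) ->
  g 1 <= g 0 + g1 0 + 2^-1 * g2 0.
Proof.
move=> dg dg1 dg2 g3le0.
have sub (s r : R) : 0 <= s <= 1 -> 0 <= r <= s -> 0 <= r <= 1.
  by move=> /andP[_ s1] /andP[-> /le_trans->].
have g2le s : 0 <= s <= 1 -> g2 s <= g2 0.
  move=> s01; have /andP[s0 s1] := s01.
  apply: (@derive_le0_le R g2 g3 0 s) => // r /(sub s r s01); first exact: dg2.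
  exact: g3le0.
have g1le s : 0 <= s <= 1 -> g1 s <= g1 0 + s * g2 0.
  move=> s01; have /andP[s0 s1] := s01.
  have := @derive_le0_le R (fun r => g1 r - r * g2 0) (fun r => g2 r - g2 0) 0 s s0.
  rewrite mul0r subr0 lerBlDr; apply=> r /(sub s r s01) r01.
    apply: is_deriveB; first exact: dg1.
    by apply: is_derive_eq; rewrite /GRing.scale/= mulr0 mulr1 add0r.
  by rewrite subr_le0 g2le.
have := @derive_le0_le R (fun r => g r - (r * g1 0 + r ^+ 2 * (2^-1 * g2 0)))
  (fun r => g1 r - (g1 0 + r * g2 0)) 0 1 ler01.
rewrite mul0r !mul1r expr0n/= mul0r expr1n mul1r addr0 subr0 lerBlDr addrA; apply=> r r01.
  apply: is_deriveB; first exact: dg.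
  apply: is_derive_eq; rewrite /GRing.scale/=; by field.
by rewrite subr_le0 g1le.
Qed.

(** If [d < 0], an approximation with relative error [- d / 2] forces [g s - g 0 <= d * s / 2 < 0]
    for small positive [s]. *)
Lemma derive_start_ge0 (R : realType) (g : R -> R) (d : R) :
  is_derive (0 : R) 1 g d -> (forall s : R, 0 <= s <= 1 -> g 0 <= g s) -> 0 <= d.
Proof.
move=> gd gmon; rewrite leNgt; apply/negP => d0.
have [|eta eta0 H] := is_derive_approx (e := - d / 2) gd.
  by rewrite divr_gt0// oppr_gt0.
pose s := Num.min 1 (eta / 2).
have s0 : 0 < s by rewrite lt_min ltr01 divr_gt0.
have s1 : s <= 1 by rewrite ge_min lexx.
have seta : s < eta by rewrite gt_min ltr_pdivrMr// ltr_pMr// ltr1n orbT.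
have := H s; rewrite subr0 ger0_norm ?(ltW s0)// => /(_ seta).
rewrite ler_norml => /andP[_]; have := gmon s; rewrite (ltW s0) s1 => /(_ isT).
have : 0 < - d * s by rewrite mulr_gt0// oppr_gt0.
lra.
Qed.

Section Cube.
Context {R : realType} {n : nat}.
Implicit Types (x y u v : 'rV[R]_n) (F : 'rV[R]_n -> R) (U : set 'rV[R]_n).

Lemma cube_segment x u (s : R) :
  unit_cube x -> unit_cube (x + u) -> 0 <= s <= 1 -> unit_cube (x + s *: u).
Proof.
move=> [x0 x1] [y0 y1] /andP[s0 s1].
by split=> i; have := x0 i; have := x1 i; have := y0 i; have := y1 i;
  rewrite !mxE; nra.
Qed.

Lemma compact_cube : compact (@unit_cube R n).
Proof.
have := @rV_compact R n (fun=> `[0, 1]%classic) (fun=> @segment_compact R 0 1).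
congr compact; apply/seteqP; split=> x /=.
  by move=> H; split=> i; have := H i; rewrite /= in_itv/= !mxE => /andP[].
by move=> [x0 x1] i; rewrite /= in_itv/=; have := x0 i; have := x1 i; rewrite !mxE => -> ->.
Qed.

Lemma CkW k U F : Ck k.+1 U F -> Ck k U F.
Proof.
elim: k F => [F [cF _]|k IHk F [cF dF]]; first by split.
by split=> // i; have [dFi CF] := dF i; split=> //; exact: IHk.
Qed.

Lemma Ck_partial k U F i : Ck k.+1 U F -> Ck k U (partial i F).
Proof. by move=> [_ /(_ i)[]]. Qed.

Lemma Ck_continuous k U F x : Ck k U F -> U x -> {for x, continuous F}.
Proof. by case: k => [|k] [+ _]; apply. Qed.

Lemma Ck1_is_derive_segment U F x u (s : R) :
  open U -> unit_cube `<=` U -> Ck 1 U F -> unit_cube x ->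
  unit_cube (x + u) -> 0 <= s <= 1 ->
  is_derive s 1 (fun s => F (x + s *: u)) (dotv u (grad F (x + s *: u))).
Proof.
move=> oU cU CF cx cxu s01; apply: is_derive_line.
by apply: (Ck1_is_derive _ oU CF); apply: cU; exact: cube_segment.
Qed.

Lemma quad_hessE F x u :
  (u *m hess F x *m u^T) ord0 ord0 =
  \sum_j u ord0 j * dotv u (grad (partial j F) x).
Proof.
rewrite mxE; apply: eq_bigr => j _; rewrite mulrC [X in X * _]mxE mxE.
by congr (_ * _); apply: eq_bigr => i _; rewrite !mxE.
Qed.

Lemma norm1_ge0 u : 0 <= norm1 u.
Proof. by apply: sumr_ge0. Qed.

Lemma norm1_eq0 u : (norm1 u == 0) = (u == 0).
Proof.
apply/idP/eqP => [|->].
  rewrite psumr_eq0// => /allP u0; apply/rowP => i; rewrite mxE.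
  by apply/normr0_eq0/eqP; apply: u0; rewrite mem_index_enum.
by rewrite /norm1 big1// => i _; rewrite mxE normr0.
Qed.

Lemma grad_dot_ge0 U F x u :
  open U -> unit_cube `<=` U -> Ck 1 U F -> monotone_on_cube F ->
  lev 0 u -> unit_cube x -> unit_cube (x + u) -> 0 <= dotv u (grad F x).
Proof.
move=> oU cU CF mon u0 cx cxu.
have := @derive_start_ge0 R (fun s => F (x + s *: u)) (dotv u (grad F x)).
apply.
  have -> : grad F x = grad F (x + 0 *: u) by rewrite scale0r addr0.
  by apply: (Ck1_is_derive_segment oU) => //; rewrite lexx ler01.
move=> s s01; rewrite scale0r addr0; apply: mon => //; first exact: cube_segment.
move=> i; rewrite !mxE lerDl mulr_ge0//; first by case/andP: s01.
by have := u0 i; rewrite mxE.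
Qed.

(* Third derivatives being non-positive, the second-order Taylor polynomial
   along [u] is an upper bound; smoothness controls its quadratic term. *)
Lemma one_sided_smooth_gain U F (sigma k : R) x u :
  open U -> unit_cube `<=` U -> Ck 3 U F -> monotone_on_cube F ->
  0 <= sigma -> one_sided_smooth sigma F -> third_partials_nonpos F ->
  lev 0 u -> unit_cube x -> unit_cube (x + u) -> x != 0 ->
  norm1 u <= k * norm1 x ->
  F (x + u) - F x <= (1 + sigma * k) * dotv u (grad F x).
Proof.
move=> oU cU CF mon s0 smooth third u0 cx cxu xn0 uk.
have CF2 j := Ck_partial j CF.
have CF1 i j := Ck_partial i (CF2 j).
have u0' i : 0 <= u ord0 i by have := u0 i; rewrite mxE.
(* [g2] and [g3] are the second and third derivatives of [F] along the segment. The innermost sum is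
   kept as a gradient pairing, the form in which differentiation along a segment produces it. *)
pose g2 s := \sum_j u ord0 j * dotv u (grad (partial j F) (x + s *: u)).
pose g3 s := \sum_j u ord0 j * \sum_i u ord0 i *
  dotv u (grad (partial i (partial j F)) (x + s *: u)).
have := @taylor2_le R (fun s => F (x + s *: u))
  (fun s => dotv u (grad F (x + s *: u))) g2 g3.
have E1 : (fun s => dotv u (grad F (x + s *: u))) =
    (fun s => \sum_j u ord0 j * partial j F (x + s *: u)).
  by apply/funext => s; apply: eq_bigr => j _; rewrite mxE.
have E2 : g2 = (fun s => \sum_j u ord0 j *
    \sum_i u ord0 i * partial i (partial j F) (x + s *: u)).
  apply/funext => s; apply: eq_bigr => j _; congr (_ * _).
  by apply: eq_bigr => i _; rewrite mxE.
rewrite scale1r scale0r addr0 => T.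
have {}T : F (x + u) <= F x + dotv u (grad F x) + 2^-1 * g2 0.
  apply: T => s s01.
  - by apply: (Ck1_is_derive_segment oU cU) => //; do 2 apply: CkW.
  - rewrite E1; apply: is_derive_lincomb => j.
    by apply: (Ck1_is_derive_segment oU cU) => //; apply: CkW.
  - rewrite E2; apply: is_derive_lincomb => j; apply: is_derive_lincomb => i.
    exact: (Ck1_is_derive_segment oU cU).
  - rewrite /g3 -oppr_ge0 -sumrN sumr_ge0// => j _; rewrite -mulrN mulr_ge0//.
    rewrite -sumrN sumr_ge0// => i _; rewrite -mulrN mulr_ge0//.
    rewrite -sumrN sumr_ge0// => l _; rewrite -mulrN mulr_ge0// mxE oppr_ge0.
    by apply: third; exact: cube_segment.
have := smooth u x u0 cx xn0; rewrite quad_hessE => sm.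
(* This sign allows the ratio [norm1 u / norm1 x] to be replaced by its upper bound [k]. *)
have G : 0 <= dotv u (grad F x).
  by apply: (@grad_dot_ge0 U) => //; do 2 apply: CkW.
have xpos : 0 < norm1 x by rewrite lt_def norm1_eq0 xn0 norm1_ge0.
have : sigma * (norm1 u / norm1 x) * dotv u (grad F x) <=
    sigma * k * dotv u (grad F x).
  by rewrite ler_wpM2r// ler_wpM2l// ler_pdivrMr.
move: T sm; rewrite /g2 scale0r addr0; lra.
Qed.

(** The partial derivatives are bounded on the compact cube, and the mean value theorem applies
    along segments. The Lipschitz bound transfers absolute continuity from [x] to [F \o x]. *)
Lemma cube_lipschitz U F :
  open U -> unit_cube `<=` U -> Ck 1 U F ->
  exists2 M : R, 0 <= M &
    forall x y, unit_cube x -> unit_cube y -> `|F y - F x| <= M * `|y - x|.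
Proof.
move=> oU cU CF.
have cube0 : unit_cube (0 : 'rV[R]_n) by split=> i; rewrite !mxE ?lexx ?ler01.
have bnd i : exists M, forall y, unit_cube y -> `|partial i F y| <= M.
  have [|c _ H] := @compact_EVT_max _ R (fun y => `|partial i F y|) _
    (ex_intro _ _ cube0) compact_cube.
    apply: continuous_in_subspaceT => y; rewrite inE => /cU Uy.
    apply: continuous_comp; last exact: norm_continuous.
    exact: (Ck_continuous (Ck_partial i CF)).
  by exists `|partial i F c| => y cy; apply: H; rewrite inE.
have [M HM] := choice bnd.
have M0 i : 0 <= M i by apply: le_trans (HM i 0 cube0).
exists (n%:R * \sum_i M i); first by rewrite mulr_ge0// sumr_ge0.
move=> x y cx cy; have yE : x + (y - x) = y by rewrite addrC subrK.
have [|s s01] := @MVT_between R (fun s => F (x + s *: (y - x)))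
    (fun s => dotv (y - x) (grad F (x + s *: (y - x)))) 0 1.
  rewrite min_l// max_r// => s s01.
  by apply: (Ck1_is_derive_segment oU cU); rewrite ?yE.
rewrite min_l// max_r// in s01.
rewrite scale1r scale0r addr0 subr0 mulr1 yE => ->.
apply: dotv_norm_le => i; rewrite mxE.
apply: (@le_trans _ _ (M i)).
  by apply: HM; apply: cube_segment; rewrite ?yE.
by rewrite (bigD1 i)//= lerDl sumr_ge0.
Qed.

End Cube.

(** * Caratheodory solutions and the jump-start trajectory *)

(** The summand [t - s] accommodates functions that also depend explicitly on time, such as an
    exponential factor or a linear term. *)
Lemma abs_continuous_dominated (R : realType) (V W : normedModType R)
    (a b K : R) (x : R -> V) (g : R -> W) :
  0 <= K ->
  (forall s t, a <= s -> s <= t -> t <= b ->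
     `|g t - g s| <= K * (`|x t - x s| + (t - s))) ->
  abs_continuous a b x -> abs_continuous a b g.
Proof.
(* The factor [2] splits [e] between the variation of [x] and the total length; [K + 1] covers
   [K = 0] and makes the final inequality strict. *)
move=> K0 dom xAC e e0; pose e' := e / (2 * (K + 1)).
have e'0 : 0 < e' by rewrite divr_gt0// mulr_gt0// ltr_wpDl.
have [d d0 Hd] := xAC e' e'0.
exists (Num.min d e') => [|m l r lr triv]; first by rewrite lt_min d0.
rewrite lt_min => /andP[Sd Se].
have Sx := Hd m l r lr triv Sd.
apply: (@le_lt_trans _ _ (K * (e' + e'))).
  apply: (@le_trans _ _ (\sum_k K * (`|x (r k) - x (l k)| + (r k - l k)))).
    by apply: ler_sum => k _; have [? ? ?] := lr k; exact: dom.
  by rewrite -mulr_sumr ler_wpM2l// big_split/= lerD// ltW.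
have K1 : K + 1 != 0 by rewrite gt_eqF// ltr_wpDl.
have -> : K * (e' + e') = e * K / (K + 1) by rewrite /e'; field.
by rewrite ltr_pdivrMr ?ltr_wpDl// ltr_pM2l// ltrDl.
Qed.

(** With the integrating factor [expR (c * t)], the derivative of [h] is
    [expR (c * t) * (d - c * (M - f t))], which is nonnegative. The bound [B] is what makes the
    product [h] absolutely continuous. *)
Lemma gronwall_gap (R : realType) (f : R -> R) (c B M : R) :
  0 <= c -> abs_continuous 0 1 f -> (forall t, 0 <= t <= 1 -> `|f t| <= B) ->
  {ae (@lebesgue_measure R), forall t : R, 0 < t < 1 ->
     exists2 d : R, c * (M - f t) <= d & is_derive t 1 f d} ->
  M - f 1 <= expR (- c) * (M - f 0).
Proof.
move=> c0 fAC fB dfae.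
pose h t := expR (c * t) * (f t - M).
have dexp (t : R) : is_derive t 1 (fun t => expR (c * t)) (c * expR (c * t)).
  by apply: is_derive_eq; rewrite /GRing.scale/= mulr1 mulrC.
have B0 : 0 <= B by apply: le_trans (fB 0 _); rewrite ?lexx ?ler01.
have hAC : abs_continuous 0 1 h.
  apply: (@abs_continuous_dominated _ _ _ _ _ (expR c * (1 + c * (B + `|M|))) f) => //.
    by rewrite mulr_ge0 ?expR_ge0// addr_ge0// mulr_ge0// addr_ge0.
  move=> s t s0 st t1.
  have e1 r : r <= t -> expR (c * r) <= expR c.
    move=> rt; rewrite ler_expR ler_piMr//; exact: le_trans t1.
  have -> : h t - h s = expR (c * t) * (f t - f s) +
      (expR (c * t) - expR (c * s)) * (f s - M) by rewrite /h; ring.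
  apply: (le_trans (ler_normD _ _)).
  rewrite !normrM (ger0_norm (expR_ge0 _)).
  have De : `|expR (c * t) - expR (c * s)| <= c * expR c * (t - s).
    have [r] := @MVT_between R (fun t => expR (c * t))
      (fun t => c * expR (c * t)) s t (fun r _ => dexp r).
    rewrite min_l// max_r// => /andP[_ rt] ->.
    rewrite normrM [X in _ * X <= _]ger0_norm ?subr_ge0// ler_wpM2r ?subr_ge0//.
    by rewrite ger0_norm ?mulr_ge0 ?expR_ge0// ler_wpM2l// e1.
  have fM : `|f s - M| <= B + `|M|.
    apply: (le_trans (ler_normB _ _)); rewrite lerD2r fB// s0/=; exact: le_trans t1.
  have T1 : expR (c * t) * `|f t - f s| <= expR c * `|f t - f s|.
    by rewrite ler_wpM2r// e1.
  have T2 : `|expR (c * t) - expR (c * s)| * `|f s - M| <=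
      c * expR c * (t - s) * (B + `|M|) by rewrite ler_pM.
  apply: (le_trans (lerD T1 T2)).
  have T3 : 0 <= expR c * (c * (B + `|M|)) * `|f t - f s|.
    by rewrite !mulr_ge0 ?expR_ge0 ?addr_ge0.
  have T4 : 0 <= expR c * (t - s) by rewrite mulr_ge0 ?expR_ge0 ?subr_ge0.
  nra.
have : h 0 <= h 1.
  apply: abs_continuous_ae_deriv_ge0_le => //.
  apply: negligibleS dfae; apply: subsetC => t H t01; have [d dge fd] := H t01.
  exists (expR (c * t) * d + (f t - M) * (c * expR (c * t))).
    have -> : expR (c * t) * d + (f t - M) * (c * expR (c * t)) =
      expR (c * t) * (d - c * (M - f t)) by ring.
    by rewrite mulr_ge0 ?expR_ge0// subr_ge0.
  have dM : is_derive t 1 (fun t => f t - M) d.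
    by apply: is_derive_eq; rewrite subr0.
  exact: (@is_deriveM _ _ _ _ _ _ _ _ (dexp t) dM).
rewrite /h mulr0 expR0 mul1r mulr1 expRN => H.
rewrite ler_pdivlMl ?expR_gt0//; lra.
Qed.

(** The function [c * s - dotr g (x s)] is absolutely continuous with nonnegative derivative almost
    everywhere. Testing against one linear functional at a time reduces vector statements to the
    scalar monotonicity principle. *)
Lemma ode_solution_dot_le (R : realType) (n : nat)
    (f : 'rV[R]_n -> 'rV[R]_n) (x0 : 'rV[R]_n) (a b : R) (x : R -> 'rV[R]_n)
    (g : 'rV[R]_n) (c : R) :
  ode_solution f x0 a b x ->
  (forall t, a < t < b -> dotv (f (x t)) g <= c) ->
  forall t, a <= t <= b -> dotv (x t) g <= dotv x0 g + c * (t - a).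
Proof.
move=> [xAC xa dx] fc t /andP[age tb].
pose h s := c * s - dotr g (x s).
have hAC : abs_continuous a t h.
  apply: abs_continuousW tb _.
  pose M := \sum_i `|g ord0 i|.
  have M0 : 0 <= M by exact: sumr_ge0.
  apply: (@abs_continuous_dominated _ _ _ _ _ (`|c| + n%:R * M) x) => //.
    by rewrite addr_ge0// mulr_ge0.
  move=> s r _ sr _.
  have -> : h r - h s = c * (r - s) - dotr g (x r - x s).
    by rewrite /h raddfB/=; ring.
  apply: (le_trans (ler_normB _ _)); rewrite normrM [`|r - s|]ger0_norm ?subr_ge0//.
  have T : `|dotr g (x r - x s)| <= n%:R * M * `|x r - x s|.
    apply: dotv_norm_le => i; rewrite /M (bigD1 i)//= lerDl; exact: sumr_ge0.
  have T1 : 0 <= `|c| * `|x r - x s| by rewrite mulr_ge0.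
  have T2 : 0 <= n%:R * M * (r - s) by rewrite !mulr_ge0// subr_ge0.
  rewrite mulrDl !mulrDr; lra.
have : h a <= h t.
  apply: abs_continuous_ae_deriv_ge0_le => //.
  apply: negligibleS dx; apply: subsetC => s H /andP[alt st].
  have asb : a < s < b by rewrite alt (lt_le_trans st).
  have [dxs xE] := H asb.
  exists (c - dotv (f (x s)) g); first by rewrite subr_ge0 fc.
  have dgx : is_derive s 1 (dotr g \o x) (dotv (f (x s)) g).
    have cg := @dotr_continuous R n g.
    have dx' : differentiable x s by exact/derivable1_diffP.
    have dg : differentiable (dotr g) (x s) by exact: linear_differentiable.
    have dd : differentiable (dotr g \o x) s by exact: differentiable_comp.
    split; first exact: diff_derivable.
    by rewrite deriveE// diff_comp//= diff_lin// -deriveE// xE.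
  apply: is_deriveB.
  by apply: is_derive_eq; rewrite /GRing.scale/= mulr1.
rewrite /h xa /dotr; lra.
Qed.

Lemma norm1_ge0E (R : realType) (n : nat) (u : 'rV[R]_n) :
  lev 0 u -> norm1 u = dotv u (const_mx 1).
Proof.
move=> u0; apply: eq_bigr => i _; rewrite mxE mulr1 ger0_norm//.
by have := u0 i; rewrite mxE.
Qed.

(** * Feasibility and value of the jump-start trajectory *)

Section JumpStart.
Context {R : realType} {n : nat}.
Variables (F : 'rV[R]_n -> R) (P : set 'rV[R]_n) (alpha : R).
Variables (x : R -> 'rV[R]_n) (vstar : 'rV[R]_n) (vmax : 'rV[R]_n -> 'rV[R]_n).
Hypotheses (alpha_ge0 : 0 <= alpha) (alpha_lt1 : alpha < 1).
Hypothesis P_cube : P `<=` unit_cube.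
Hypothesis vstarP : argmax P norm1 vstar.
Hypothesis vmaxP : forall y, unit_cube y ->
  argmax P (fun v => dotv v (grad F y)) (vmax y).
Hypothesis x_cube : forall t, 0 <= t <= 1 -> unit_cube (x t).
Hypothesis x_ode :
  ode_solution (fun y => (1 - alpha) *: vmax y) (alpha *: vstar) 0 1 x.

Lemma trajectory_dot_le (g : 'rV[R]_n) (c t : R) :
  (forall v, P v -> dotv v g <= c) -> 0 <= t <= 1 ->
  dotv (x t) g <= alpha * dotv vstar g + (1 - alpha) * c * t.
Proof.
move=> gc t01; have dotZ k u : dotv (k *: u) g = k * dotv u g.
  exact: (linearZ_LR (dotr g)).
rewrite -dotZ -[X in _ * X]subr0.
apply: (ode_solution_dot_le x_ode) => // s /andP[s0 s1].
rewrite dotZ ler_wpM2l ?subr_ge0 ?(ltW alpha_lt1)//.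
by apply: gc; have [] := vmaxP (x_cube (t := s) _); rewrite ?(ltW s0) ?(ltW s1).
Qed.

Lemma trajectory_end_in_polytope : polytope P -> P (x 1).
Proof.
move=> [[m [A [b PE]]] _]; rewrite PE /= => k.
have rowE (y : 'rV[R]_n) : (A *m y^T) k ord0 = dotv y (row k A).
  by rewrite mxE; apply: eq_bigr => j _; rewrite !mxE mulrC.
have Pb v : P v -> dotv v (row k A) <= b k ord0.
  by rewrite PE /= => /(_ k); rewrite rowE.
have := trajectory_dot_le (t := 1) Pb; rewrite ler01 lexx => /(_ isT).
rewrite rowE mulr1 => /le_trans; apply.
(* The weights [alpha] of the start and [1 - alpha] of the greedy directions sum to one at time
   [1]. *)
have : alpha * dotv vstar (row k A) <= alpha * b k ord0.
  by rewrite ler_wpM2l// Pb//; have [] := vstarP.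
lra.
Qed.

(** Greedy directions have nonnegative coordinates. Testing against the all-minus-ones vector, which
    is at most [0] on [P], turns the upper bound on the trajectory into a lower bound. *)
Lemma trajectory_norm1_ge (t : R) :
  0 <= t <= 1 -> alpha * norm1 vstar <= norm1 (x t).
Proof.
move=> t01; have vstar0 : lev 0 vstar by have [/P_cube[]] := vstarP.
have dotN (u : 'rV[R]_n) : lev 0 u -> dotv u (- const_mx 1) = - norm1 u.
  move=> u0; rewrite norm1_ge0E// -sumrN; apply: eq_bigr => i _.
  by rewrite !mxE mulrN.
have := @trajectory_dot_le (- const_mx 1) 0 t _ t01.
rewrite !dotN ?mulr0 ?mul0r ?addr0 ?mulrN ?lerN2//; last by case: (x_cube t01).
apply=> v Pv; rewrite dotN ?oppr_le0 ?norm1_ge0//.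
by have [] := P_cube Pv.
Qed.

Variables (U : set 'rV[R]_n) (sigma : R) (OPT : R).
Hypotheses (oU : open U) (cU : unit_cube `<=` U) (CF : Ck 3 U F).
Hypothesis F_ge0 : forall y, unit_cube y -> 0 <= F y.
Hypothesis F_monotone : monotone_on_cube F.
Hypothesis sigma_ge0 : 0 <= sigma.
Hypothesis F_smooth : one_sided_smooth sigma F.
Hypothesis F_third : third_partials_nonpos F.
Hypothesis P_down : downward_closed P.
Hypothesis OPT_max : is_max P F OPT.

Let rate := alpha * (1 - alpha) / (alpha + sigma).

(* The greedy direction beats [u = (x* - x)^+], which lies in [P] because [P]
   is downward closed, and [x + u] dominates the optimum [x*]. *)
Lemma greedy_gain (t : R) :
  0 < alpha -> 0 < norm1 vstar -> 0 <= t <= 1 ->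
  rate * (OPT - F (x t)) <=
    dotv ((1 - alpha) *: vmax (x t)) (grad F (x t)).
Proof.
move=> a0 v0 t01; have cx := x_cube t01; have [x0 x1] := cx.
have [[xs Pxs FxsE] _] := OPT_max; have [xs0 xs1] := P_cube Pxs.
pose u : 'rV[R]_n := \row_i Num.max 0 (xs ord0 i - x t ord0 i).
have u0 : lev 0 u by move=> i; rewrite !mxE le_max lexx.
have xuE i : (x t + u) ord0 i = Num.max (x t ord0 i) (xs ord0 i).
  by rewrite !mxE addr_maxr addr0 addrC subrK.
have Pu : P u.
  apply: P_down Pxs u0 _ => i; rewrite mxE ge_max.
  by have := xs0 i; have := x0 i; rewrite !mxE gerBl => -> ->.
(* The join of [x t] and the optimum may leave [P], but it stays in the cube, where smoothness and
   monotonicity hold. *)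
have cxu : unit_cube (x t + u).
  split=> i; rewrite xuE; last by rewrite ge_max x1 xs1.
  by rewrite le_max x0.
have xpos : 0 < norm1 (x t).
  by apply: lt_le_trans (trajectory_norm1_ge t01); rewrite mulr_gt0.
have xn0 : x t != 0 by rewrite -norm1_eq0 gt_eqF.
have uk : norm1 u <= alpha^-1 * norm1 (x t).
  rewrite ler_pdivlMl//; apply: le_trans (trajectory_norm1_ge t01).
  by rewrite ler_pM2l//; have [_] := vstarP; apply.
have gain := one_sided_smooth_gain oU cU CF F_monotone sigma_ge0 F_smooth
  F_third u0 cx cxu xn0 uk.
have FO : OPT <= F (x t + u).
  by rewrite -FxsE; apply: F_monotone => // i; rewrite xuE le_max lexx orbT.
have best : dotv u (grad F (x t)) <= dotv (vmax (x t)) (grad F (x t)).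
  by have [_] := vmaxP cx; apply.
have as0 : 0 < alpha + sigma by rewrite ltr_pwDl.
have -> : dotv ((1 - alpha) *: vmax (x t)) (grad F (x t)) =
    (1 - alpha) * dotv (vmax (x t)) (grad F (x t)).
  exact: (linearZ_LR (dotr _)).
apply: (@le_trans _ _ ((1 - alpha) * dotv u (grad F (x t)))); last first.
  by rewrite ler_wpM2l// subr_ge0 ltW.
(* The factor [alpha / (alpha + sigma)] is the inverse of [1 + sigma / alpha]. *)
have -> : dotv u (grad F (x t)) = alpha / (alpha + sigma) *
    ((1 + sigma * alpha^-1) * dotv u (grad F (x t))).
  field; rewrite (gt_eqF a0) (gt_eqF as0)//.
rewrite /rate -!mulrA mulrCA ler_wpM2l ?subr_ge0 ?(ltW alpha_lt1)//.
rewrite ler_wpM2l// ler_wpM2l ?invr_ge0 ?(ltW as0)//.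
by apply: le_trans gain; rewrite lerD2r.
Qed.

Lemma OPT_ge0 : 0 <= OPT.
Proof. by have [[v Pv <-] _] := OPT_max; apply/F_ge0/P_cube. Qed.

Lemma rate_ge0 : 0 <= rate.
Proof.
by rewrite /rate divr_ge0 ?addr_ge0// mulr_ge0// subr_ge0 ltW.
Qed.

Lemma trajectory_end_value :
  polytope P -> (1 - expR (- rate)) * OPT <= F (x 1).
Proof.
move=> Ppoly; have Px1 := trajectory_end_in_polytope Ppoly.
have cx1 := P_cube Px1.
(* For [alpha = 0] the rate vanishes and the claim is [0 <= F (x 1)]. *)
have [a0|an0] := eqVneq alpha 0.
  by rewrite /rate a0 !mul0r oppr0 expR0 subrr mul0r F_ge0.
have a0 : 0 < alpha by rewrite lt_def an0.
(* If the longest vector of [P] is zero, then [P] is the origin alone and [x 1] is optimal.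
   Otherwise the trajectory avoids the origin, where smoothness says nothing. *)
have [v0|vn0] := eqVneq (norm1 vstar) 0.
  have P0 w : P w -> w = 0.
    move=> Pw; apply/eqP; rewrite -norm1_eq0 eq_le norm1_ge0 -v0 andbT.
    by have [_] := vstarP; apply.
  have -> : F (x 1) = OPT.
    by have [[w Pw <-] _] := OPT_max; rewrite (P0 _ Pw) (P0 _ Px1).
  by rewrite ler_piMl ?OPT_ge0// gerBl expR_ge0.
have v0 : 0 < norm1 vstar by rewrite lt_def vn0 norm1_ge0.
have CF1 : Ck 1 U F by do 2 apply: CkW.
have [M M0 lip] := cube_lipschitz oU cU CF1.
have [xAC xE dx] := x_ode.
have FxAC : abs_continuous 0 1 (F \o x).
  apply: (abs_continuous_dominated M0 _ xAC) => s t s0 st t1.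
  have s1 : s <= 1 by exact: le_trans t1.
  have t0 : 0 <= t by exact: le_trans st.
  apply: (@le_trans _ _ (M * `|x t - x s|)).
    by apply: lip; apply: x_cube; rewrite ?s0 ?t0.
  by rewrite ler_wpM2l// lerDl subr_ge0.
have FxB t : 0 <= t <= 1 -> `|(F \o x) t| <= F (const_mx 1).
  move=> /x_cube cx; rewrite /= ger0_norm ?F_ge0//.
  apply: F_monotone => //; last by case: cx.
  by split=> i; rewrite !mxE ?ler01.
have gap : OPT - F (x 1) <= expR (- rate) * (OPT - F (x 0)).
  apply: (gronwall_gap rate_ge0 FxAC FxB).
  apply: negligibleS dx; apply: subsetC => t H t01.
  have t01' : 0 <= t <= 1 by case/andP: t01 => t0 t1; rewrite !ltW.
  exists (dotv ((1 - alpha) *: vmax (x t)) (grad F (x t))).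
    exact: greedy_gain.
  apply: (Ck1_is_derive_comp oU CF1); first exact/cU/x_cube.
  exact: H.
have : expR (- rate) * (OPT - F (x 0)) <= expR (- rate) * OPT.
  rewrite ler_wpM2l ?expR_ge0// gerBl F_ge0//.
  by apply: x_cube; rewrite lexx ler01.
lra.
Qed.

End JumpStart.

(** This is [1 + z <= expR z] at [z = 1 / y], inverted. *)
Lemma inv_succ_le_onem_expRN (R : realType) (y : R) :
  0 < y -> 1 / (y + 1) <= 1 - expR (- (1 / y)).
Proof.
move=> y0; have y1 : 0 < y + 1 by rewrite ltr_wpDr.
have e1 : 1 + 1 / y <= expR (1 / y) by exact: expR_ge1Dx.
have -> : 1 / (y + 1) = 1 - (1 + 1 / y)^-1.
  by field; rewrite (gt_eqF y0) (gt_eqF y1).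
by rewrite lerB// expRN lef_pV2// posrE ?expR_gt0// ltr_wpDr// divr_ge0// ltW.
Qed.

Theorem theorem2 (R : realType) (n : nat) (sigma : R) (F : 'rV[R]_n -> R)
    (alpha : R) (P : set 'rV[R]_n) (x : R -> 'rV[R]_n) (OPT : R)
    (sigma_ge0 : 0 <= sigma)
    (F_ge0 : forall y, unit_cube y -> 0 <= F y)
    (F_C3 : C3_on_cube F)
    (F_monotone : monotone_on_cube F)
    (F_smooth : one_sided_smooth sigma F)
    (F_third : third_partials_nonpos F)
    (alpha_ge0 : 0 <= alpha) (alpha_lt1 : alpha < 1)
    (P_cube : P `<=` unit_cube)
    (P_polytope : polytope P)
    (P_down : downward_closed P)
    (x_traj : jump_start_trajectory F P alpha x)
    (OPT_max : is_max P F OPT) :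
  [/\ P (x 1),
      F (x 1) >= (1 - expR (- (alpha * (1 - alpha) / (alpha + sigma)))) * OPT &
      alpha = 2^-1 ->
        F (x 1) >= (1 - expR (- (1 / (4 * sigma + 2)))) * OPT /\
        (1 - expR (- (1 / (4 * sigma + 2)))) * OPT >= 1 / (4 * sigma + 3) * OPT].
Proof.
have [vstar [vmax [vstarP vmaxP x_cube x_ode]]] := x_traj.
have [U [oU cU CF]] := F_C3.
have value := trajectory_end_value alpha_ge0 alpha_lt1 P_cube vstarP vmaxP
  x_cube x_ode oU cU CF F_ge0 F_monotone sigma_ge0 F_smooth F_third P_down
  OPT_max P_polytope.
split=> //.
  exact: (trajectory_end_in_polytope alpha_ge0 alpha_lt1 vstarP vmaxP x_cube x_ode).
move=> aE; have s2 : 0 < 4 * sigma + 2 by rewrite ltr_wpDl// mulr_ge0.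
split.
  (* At [alpha = 1/2] the rate is [(1/4) / (1/2 + sigma)]. *)
  have -> : 1 / (4 * sigma + 2) = alpha * (1 - alpha) / (alpha + sigma).
    rewrite aE; field; lra.
  exact: value.
rewrite ler_wpM2r ?(OPT_ge0 P_cube F_ge0 OPT_max)//.
have -> : 4 * sigma + 3 = 4 * sigma + 2 + 1 by ring.
exact: inv_succ_le_onem_expRN.
Qed.
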